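(* Let $G$ be a locally compact abelian metric group with Haar measure $\lambda$, $\lambda(G)<\infty$, and let $\hat G$ be its dual. Let $1<p_i<\infty$, $p_i'=\frac{p_i}{p_i-1}$ $(i=1,2,3)$, $\theta\ge 0$. Let $A$ be an automorphism of $G$ and $m\in BM_\theta[(p_1';(p_2';(p_3']$. If $\frac1q=\frac1{p_1'}+\frac1{p_2'}-\frac1{p_3'}$, then $\tilde D^q_{A^*}m\in BM_\theta[(p_1';(p_2';(p_3']$, where $\tilde D^q_{A^*}m(s,t)=|A^*|^{\frac1q}m(A^*s,A^*t)$. Furthermore $$\|\tilde D^q_{A^*}m\|_{[(p_1';(p_2';(p_3']_\theta}\le\|m\|_{[(p_1';(p_2';(p_3']_\theta}.$$
   Context: Setting: since $\lambda(G)<\infty$, $G$ is compact and $\hat G$ is countable and discrete; the Haar measure $\mu$ on $\hat G$ is counting measure, and $\lambda$ is normalized so that $\mu$ is its dual measure (i.e. $\lambda(G)=1$). $\langle s,x\rangle$ is the value of the character $s\in\hat G$ at $x\in G$, and $\hat f(s)=\int_G f(x)\langle s,-x\rangle\,d\lambda(x)$ for $f\in L^1(G)$. $C^\infty(G)$ is the space of infinitely differentiable complex functions on $G$ in the sense of Bruhat, i.e. functions $F\circ\pi$ with $\pi:G\to G/H$ the quotient by a closed subgroup $H$ such that $G/H$ is a Lie group and $F$ is smooth on $G/H$. Automorphisms: an automorphism $A$ of $G$ is a topological group automorphism; its modulus $|A|$ is defined by $\lambda(AU)=|A|\lambda(U)$ for Borel $U\subseteq G$. Its adjoint $A^*$ is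 the automorphism of $\hat G$ with $\langle Ax,s\rangle=\langle x,A^*s\rangle$ for $x\in G$, $s\in\hat G$; $|A^*|$ is its modulus with respect to $\mu$, and $|A^*|=|A|$. The symbol $\frac1q$ denotes a real number defined by the stated equation. Small Lebesgue space: for $1<p<\infty$, $p'=\frac{p}{p-1}$, $\theta\ge 0$, $L^{(p',\theta}(G)$ is the space of measurable complex functions $g$ with $$\|g\|_{(p',\theta}=\inf_{g=\sum_{k=1}^\infty g_k}\ \sum_{k=1}^\infty\ \inf_{0<\varepsilon<p-1}\varepsilon^{-\frac{\theta}{p-\varepsilon}}\Big(\int_G|g_k|^{(p-\varepsilon)'}d\lambda\Big)^{\frac1{(p-\varepsilon)'}}<\infty,$$ the outer infimum being over all decompositions of $g$ (a.e.) into series of a.e. finite measurable functions $g_k$, and $(p-\varepsilon)'=\frac{p-\varepsilon}{p-\varepsilon-1}$. Bilinear multipliers: for bounded measurable $m$ on $\hat G\times\hat G$ and $f,g\in C^\infty(G)$ put $B_m(f,g)(x)=\sum_{s\in\hat G}\sum_{t\in\hat G}\hat f(s)\hat g(t)m(s,t)\langle s+t,x\rangle$. Then $m\in BM_\theta[(p_1';(p_2';(p_3']$ if there is $C>0$ with $\|B_m(f,g)\|_{(p_3',\theta}\le C\|f\|_{(p_1',\theta}\|g\|_{(p_2',\theta}$ for all $f,g\in C^\infty(G)$ (so that $B_m$ extends to a bounded bilinear operator $L^{(p_1',\theta}(G)\times L^{(p_2',\theta}(G)\to L^{(p_3',\theta}(G)$); $\|m\|_{[(p_1';(p_2';(p_3']_\theta}=\|B_m\|$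 is the least such $C$. *)

(* Defs.v *)
From HB Require Import structures.
From mathcomp Require Import all_boot all_order all_algebra.
From mathcomp Require Import all_classical all_reals all_analysis.
From mathcomp Require Import complex ring_quotient generic_quotient.

Set Implicit Arguments.
Unset Strict Implicit.
Unset Printing Implicit Defensive.

Import Order.TTheory GRing.Theory Num.Theory numFieldNormedType.Exports.
Import ComplexField.Normc.

Local Open Scope classical_set_scope.
Local Open Scope ring_scope.
Local Open Scope complex_scope.

(* The distance is not assumed to be invariant. *)
Definition metrizes (R : realType) (T : topologicalType) (d : T -> T -> R)
    : Prop :=
  [/\ forall x y, d x y = 0 <-> x = y,
      forall x y, d x y = d y x,
      forall x y z, d x z <= d x y + d y z &
      forall (x : T) (U : set T),
        nbhs x U <-> exists2 e : R, 0 < e & [set y | d x y < e] `<=` U ].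

(* Measurable types carry a point; here it is 0. *)
Definition pointed_group (G : topologicalZmodType) : Type := G.
HB.instance Definition _ (G : topologicalZmodType) :=
  Choice.on (pointed_group G).
HB.instance Definition _ (G : topologicalZmodType) :=
  isPointed.Build (pointed_group G) (0 : G).

Definition borelType (G : topologicalZmodType) : Type :=
  @g_sigma_algebraType (pointed_group G) (@open G).
HB.instance Definition _ (G : topologicalZmodType) :=
  Measurable.copy (borelType G) (@g_sigma_algebraType (pointed_group G) (@open G)).

Definition is_haar (R : realType) (G : topologicalZmodType)
    (lambda : {measure set (borelType G) -> \bar R}) : Prop :=
  [/\ lambda [set: G] != 0%E,
      forall (x : G) (U : set (borelType G)), measurable U ->
        lambda [set x + u | u in (U : set G)] = lambda U,
      forall K : set G, compact K -> (lambda K < +oo)%E,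
      forall U : set (borelType G), measurable U ->
        lambda U = ereal_inf [set lambda V | V in
          [set V : set G | open V /\ U `<=` V]] &
      forall V : set G, open V ->
        lambda V = ereal_sup [set lambda K | K in
          [set K : set G | compact K /\ K `<=` V]] ].

Section Dual.
Variables (R : realType) (G : topologicalZmodType).

(* [R[i]] gets its topology from its structure of numFieldType. *)
Record dual := Dual {
  char_val :> G -> R[i] ;
  char_continuous : continuous (char_val : G -> (R[i] : numFieldType)) ;
  char_norm1 : forall x, normc (char_val x) = 1 ;
  char_add : forall x y, char_val (x + y) = char_val x * char_val y
}.

Lemma dual_ext (s t : dual) : (forall x, s x = t x) -> s = t.
Proof.
case: s t => [s s1 s2 s3] [t t1 t2 t3] /= st.
have {}st : s = t by apply/funext.
by subst t; congr Dual; exact: Prop_irrelevance.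
Qed.

HB.instance Definition _ := gen_eqMixin dual.
HB.instance Definition _ := gen_choiceMixin dual.

Lemma char_neq0 (s : dual) x : s x != 0.
Proof.
apply/eqP => sx0; have := char_norm1 s x; rewrite sx0 normc0 => /eqP.
by rewrite eq_sym oner_eq0.
Qed.

Lemma char0 (s : dual) : s 0 = 1.
Proof.
have := char_add s 0 0; rewrite addr0 -{1}[s 0]mulr1 => /esym.
by move/(mulfI (char_neq0 s 0)).
Qed.

Lemma char_opp (s : dual) x : s (- x) = (s x)^-1.
Proof.
apply: (mulfI (char_neq0 s x)).
by rewrite -char_add subrr char0 divff// char_neq0.
Qed.

Program Definition dual_zero := @Dual (fun=> 1) _ _ _.
Next Obligation. by move=> x; exact: cvg_cst. Qed.
Next Obligation. by move=> x; exact: normc1. Qed.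
Next Obligation. by move=> x y; rewrite mulr1. Qed.

Program Definition dual_add (s t : dual) := @Dual (fun x => s x * t x) _ _ _.
Next Obligation.
move=> s t x; apply: (@cvgM (R[i] : numFieldType)).
  exact: char_continuous.
exact: char_continuous.
Qed.
Next Obligation. by move=> s t x; rewrite normcM !char_norm1 mulr1. Qed.
Next Obligation. by move=> s t x y /=; rewrite !char_add mulrACA. Qed.

Program Definition dual_opp (s : dual) := @Dual (fun x => s (- x)) _ _ _.
Next Obligation.
move=> s x.
apply: (@continuous_comp _ _ _ (-%R : G -> G) (s : G -> (R[i] : numFieldType))).
  exact: opp_continuous.
exact: char_continuous.
Qed.
Next Obligation. by move=> s x; rewrite char_norm1. Qed.
Next Obligation. by move=> s x y /=; rewrite opprD char_add. Qed.

Lemma dual_addA : associative dual_add.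
Proof. by move=> s t u; apply: dual_ext => x /=; rewrite mulrA. Qed.
Lemma dual_addC : commutative dual_add.
Proof. by move=> s t; apply: dual_ext => x /=; rewrite mulrC. Qed.
Lemma dual_add0 : left_id dual_zero dual_add.
Proof. by move=> s; apply: dual_ext => x /=; rewrite mul1r. Qed.
Lemma dual_addN : left_inverse dual_zero dual_opp dual_add.
Proof.
by move=> s; apply: dual_ext => x /=; rewrite char_opp mulVf// char_neq0.
Qed.

HB.instance Definition _ :=
  GRing.isZmodule.Build dual dual_addA dual_addC dual_add0 dual_addN.

End Dual.

Record topAut (G : topologicalZmodType) := TopAut {
  aut_val :> G -> G ;
  aut_inv : G -> G ;
  aut_add : forall x y, aut_val (x + y) = aut_val x + aut_val y ;
  aut_invK : cancel aut_val aut_inv ;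
  aut_valK : cancel aut_inv aut_val ;
  aut_continuous : continuous aut_val ;
  aut_inv_continuous : continuous aut_inv
}.

Section Adjoint.
Variables (R : realType) (G : topologicalZmodType) (A : topAut G).

Program Definition adjoint (s : dual R G) : dual R G :=
  @Dual R G (fun x => s (A x)) _ _ _.
Next Obligation.
move=> s x.
apply: (@continuous_comp _ _ _ (A : G -> G) (s : G -> (R[i] : numFieldType))).
  exact: aut_continuous.
exact: char_continuous.
Qed.
Next Obligation. by move=> s x; rewrite char_norm1. Qed.
Next Obligation. by move=> s x y /=; rewrite aut_add char_add. Qed.

End Adjoint.

(* The Haar measure of the dual, which is discrete, is the counting measure,
   and every subset of the dual is a Borel set. *)
Definition dual_modulus (R : realType) (G : topologicalZmodType)
    (B : dual R G -> dual R G) : R :=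
  xget 0 [set c : R | forall U : set (dual R G),
    counting (B @` U) = (c%:E * counting U)%E].

Definition cintegral d (T : measurableType d) (R : realType)
    (mu : {measure set T -> \bar R}) (f : T -> R[i]) : R[i] :=
  Rintegral mu setT (fun x => complex.Re (f x)) +i*
  Rintegral mu setT (fun x => complex.Im (f x)).

Definition cmeasurable d (T : measurableType d) (R : realType) (f : T -> R[i])
    : Prop :=
  measurable_fun setT (fun x => complex.Re (f x)) /\
  measurable_fun setT (fun x => complex.Im (f x)).

(* Sums of absolutely summable families, i.e. integrals for the counting
   measure: positive and negative parts are summed separately. The families
   below are absolutely summable, as Fourier coefficients of smooth functions
   are. *)
Definition rsum (I : choiceType) (R : realType) (h : I -> R) : R :=
  fine (\esum_(i in [set: I]) (Num.max (h i) 0)%:E) -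
  fine (\esum_(i in [set: I]) (Num.max (- h i) 0)%:E).

Definition csum (I : choiceType) (R : realType) (h : I -> R[i]) : R[i] :=
  rsum (fun i => complex.Re (h i)) +i* rsum (fun i => complex.Im (h i)).

Section Smooth.
Variable R : realType.

Fixpoint Ck_on (n : nat) (k : nat) (U : set 'rV[R]_n) (f : 'rV[R]_n -> R)
    : Prop :=
  (forall x, U x -> {for x, continuous f}) /\
  if k is k'.+1 then
    forall i : 'I_n,
      (forall x, U x -> derivable f x (delta_mx 0 i)) /\
      Ck_on k' U (fun x => 'D_(delta_mx 0 i) f x)
  else True.

Definition smooth_on (n : nat) (U : set 'rV[R]_n) (f : 'rV[R]_n -> R) : Prop :=
  forall k, Ck_on k U f.

Definition smooth_map_on (n p : nat) (U : set 'rV[R]_n)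
    (f : 'rV[R]_n -> 'rV[R]_p) : Prop :=
  forall j : 'I_p, smooth_on U (fun x => f x 0 j).

(* The values of [chart_map] outside [chart_dom], and of [chart_inv] outside
   the image of [chart_dom], are irrelevant. *)
Record chart (Q : Type) (n : nat) := Chart {
  chart_dom : set Q ;
  chart_map : Q -> 'rV[R]_n ;
  chart_inv : 'rV[R]_n -> Q
}.

Definition chart_im Q n (c : chart Q n) : set 'rV[R]_n :=
  chart_map c @` chart_dom c.

Definition is_chart (Q : topologicalType) n (c : chart Q n) : Prop :=
  [/\ open (chart_dom c), open (chart_im c),
      {in chart_dom c, cancel (chart_map c) (chart_inv c)},
      forall x, chart_dom c x -> {for x, continuous (chart_map c)} &
      forall y, chart_im c y -> {for y, continuous (chart_inv c)} ].

Definition is_smooth_atlas (Q : topologicalType) n (A : set (chart Q n))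
    : Prop :=
  [/\ forall c, A c -> is_chart c,
      forall x : Q, exists2 c, A c & chart_dom c x &
      forall c1 c2, A c1 -> A c2 ->
        smooth_map_on
          [set y | chart_im c1 y /\ chart_dom c2 (chart_inv c1 y)]
          (fun y => chart_map c2 (chart_inv c1 y)) ].

(* [n + n] coordinates on the product: [lsubmx y] and [rsubmx y] are the
   coordinates of the two factors. *)
Definition is_lie_atlas (Q : PreTopologicalZmodule.type) n (A : set (chart Q n))
    : Prop :=
  [/\ is_smooth_atlas A,
      forall c1 c2 c3, A c1 -> A c2 -> A c3 ->
        smooth_map_on
          [set y : 'rV[R]_(n + n) |
            [/\ chart_im c1 (lsubmx y), chart_im c2 (rsubmx y) &
                chart_dom c3 (chart_inv c1 (lsubmx y) +
                              chart_inv c2 (rsubmx y))]]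
          (fun y => chart_map c3 (chart_inv c1 (lsubmx y) +
                                  chart_inv c2 (rsubmx y))) &
      forall c1 c2, A c1 -> A c2 ->
        smooth_map_on
          [set y | chart_im c1 y /\ chart_dom c2 (- chart_inv c1 y)]
          (fun y => chart_map c2 (- chart_inv c1 y)) ].

Definition atlas_smooth (Q : Type) n (A : set (chart Q n)) (F : Q -> R[i])
    : Prop :=
  forall c, A c ->
    smooth_on (chart_im c) (fun y => complex.Re (F (chart_inv c y))) /\
    smooth_on (chart_im c) (fun y => complex.Im (F (chart_inv c y))).

End Smooth.

Section QuotientGroup.
Variables (G : topologicalZmodType) (H : zmodClosed G).

Definition quotient_group : Type := Quotient.quot H.
HB.instance Definition _ := GRing.Zmodule.on quotient_group.

Definition quotient_proj (x : G) : quotient_group :=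
  \pi_(Quotient.quot H)%qT x.

Let quotient_open (U : set quotient_group) : Prop :=
  open (quotient_proj @^-1` U).

Let quotient_openT : quotient_open setT.
Proof. by rewrite /quotient_open preimage_setT; exact: openT. Qed.

Let quotient_openI U V :
  quotient_open U -> quotient_open V -> quotient_open (U `&` V).
Proof. exact: openI. Qed.

Let quotient_open_bigU (I : Type) (f : I -> set quotient_group) :
  (forall i, quotient_open (f i)) -> quotient_open (\bigcup_i f i).
Proof. by move=> fo; apply: bigcup_open => i _; exact: fo. Qed.

HB.instance Definition _ := @isOpenTopological.Build quotient_group
  quotient_open quotient_openT quotient_openI quotient_open_bigU.

End QuotientGroup.

(* [G / H] is Hausdorff as [H] is closed, and it is second countable when [G]
   is compact and metrizable. *)
Definition bruhat_smooth (R : realType) (G : topologicalZmodType)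
    (f : G -> R[i]) : Prop :=
  exists (H : zmodClosed G) (n : nat) (A : set (chart R (quotient_group H) n))
         (F : quotient_group H -> R[i]),
    [/\ closed [set x : G | x \in H], is_lie_atlas A, atlas_smooth A F &
        forall x, f x = F (quotient_proj H x)].

Definition conj_exp (R : realType) (p : R) : R := p / (p - 1).

Definition series_cvg_to (K : numFieldType) (u : nat -> K) (l : K) : Prop :=
  series u @ \oo --> l.

Section Multipliers.
Variables (R : realType) (G : topologicalZmodType).
Variable lambda : {measure set (borelType G) -> \bar R}.
Variable theta : R.

(* The first argument of the norms below is [p]; the space is L^{(p', theta}. *)
Definition small_term (p : R) (g : G -> R[i]) : \bar R :=
  ereal_inf [set ((eps `^ (- (theta / (p - eps))))%:E *
      (\int[lambda]_x (normc (g x) `^ conj_exp (p - eps))%:E)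
        `^ (conj_exp (p - eps))^-1)%E
    | eps in [set eps : R | 0 < eps < p - 1]].

Definition decomposes (g : G -> R[i]) (gs : nat -> G -> R[i]) : Prop :=
  (forall k, cmeasurable (gs k : borelType G -> R[i])) /\
  {ae lambda, forall x : borelType G,
    series_cvg_to (fun k => gs k x) (g x)}.

Definition small_norm (p : R) (g : G -> R[i]) : \bar R :=
  ereal_inf [set (\sum_(0 <= k <oo) small_term p (gs k))%E
            | gs in decomposes g].

Definition fourier (f : G -> R[i]) (s : dual R G) : R[i] :=
  cintegral lambda (fun x : borelType G => f x * s (- (x : G))).

Definition bilin (m : dual R G * dual R G -> R[i]) (f g : G -> R[i]) (x : G)
    : R[i] :=
  csum (fun s : dual R G => csum (fun t : dual R G =>
    fourier f s * fourier g t * m (s, t) * (s + t) x)).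

Definition bilin_bound (p1 p2 p3 : R) (m : dual R G * dual R G -> R[i]) (C : R)
    : Prop :=
  0 < C /\ forall f g : G -> R[i], bruhat_smooth f -> bruhat_smooth g ->
    (small_norm p3 (bilin m f g) <=
       C%:E * (small_norm p1 f * small_norm p2 g))%E.

(* The dual is discrete: every function on its square is measurable. *)
Definition bilin_mult (p1 p2 p3 : R) (m : dual R G * dual R G -> R[i]) : Prop :=
  (exists M : R, forall st, normc (m st) <= M) /\
  exists C : R, bilin_bound p1 p2 p3 m C.

Definition mult_norm (p1 p2 p3 : R) (m : dual R G * dual R G -> R[i]) : \bar R :=
  ereal_inf [set C%:E | C in bilin_bound p1 p2 p3 m].

End Multipliers.

(* [c] stands for 1/q. *)
Definition dilation (R : realType) (G : topologicalZmodType) (c : R)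
    (B : dual R G -> dual R G) (m : dual R G * dual R G -> R[i])
    (st : dual R G * dual R G) : R[i] :=
  (dual_modulus B `^ c)%:C * m (B st.1, B st.2).

(* Main.v *)
(* A compact group has finite nonzero Haar measure, so |A| = 1, and |A^*| = 1
   as A^* permutes a discrete group. Substituting s -> A^* s in the sums gives
   B_{m o (A^* x A^* )}(f, g) = B_m(f o A, g o A) o A^-1; composition with A
   preserves C^oo(G) and, A being measure preserving, the small Lebesgue
   norms, so every bound for m is a bound for the dilated multiplier. *)
Require Import Defs.
From HB Require Import structures.
From mathcomp Require Import all_boot all_order all_algebra.
From mathcomp Require Import all_classical all_reals all_analysis.
From mathcomp Require Import complex.
From mathcomp Require Import finmap ring_quotient generic_quotient lra.

Set Implicit Arguments.
Unset Strict Implicit.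
Unset Printing Implicit Defensive.

Import Order.TTheory GRing.Theory Num.Theory numFieldNormedType.Exports.

Local Open Scope classical_set_scope.
Local Open Scope ring_scope.

(** * Metric balls in a metrizable space *)

Section Metrizable.
Variables (R : realType) (T : topologicalType) (d : T -> T -> R).
Hypothesis d_metric : metrizes d.

Lemma metrizes_nbhs_ball x e : 0 < e -> nbhs x [set y | d x y < e].
Proof. by case: d_metric => _ _ _ dn e0; apply/dn; exists e. Qed.

Lemma metrizes_open_ball x e : open [set y | d x y < e].
Proof.
case: d_metric => _ _ dtri dn; rewrite openE => y /= dxy.
apply/dn; exists (e - d x y); first by rewrite subr_gt0.
move=> z /= dyz; apply: le_lt_trans (dtri x y z) _; lra.
Qed.

Lemma metrizes_ball_half a x y r e :
  r < e / 2 -> d a x < r -> d a y < r -> d x y < e.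
Proof.
case: d_metric => _ dsym dtri _ re ax ay.
have := dtri x a y; rewrite (dsym x a); lra.
Qed.

Lemma metrizes_hausdorff : hausdorff_space T.
Proof.
case: d_metric => d0 dsym dtri dn p q pq; apply/(d0 p q).1.
(* Nonnegativity of the distance comes from the triangle inequality along p, q, p. *)
have dpq : 0 <= d p q.
  have := dtri p q p; rewrite (d0 p p).2// (dsym q p); lra.
apply/eqP; rewrite eq_le dpq andbT leNgt; apply/negP => d_gt0.
have e0 : 0 < d p q / 2 by lra.
have [z /= [pz qz]] :=
  pq _ _ (metrizes_nbhs_ball p e0) (metrizes_nbhs_ball q e0).
have := dtri p z q; rewrite (dsym z q); lra.
Qed.

End Metrizable.

(** * Borel measurability of continuous maps *)

Section Borel.
Variables (R : realType) (G : topologicalZmodType) (d : G -> G -> R).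
Hypothesis d_metric : metrizes d.

Lemma open_borel (U : set G) : open U -> measurable (U : set (borelType G)).
Proof. by move=> oU; apply: sub_sigma_algebra. Qed.

Lemma closed_borel (U : set G) : closed U -> measurable (U : set (borelType G)).
Proof.
move=> cU; rewrite -(setCK U); apply: measurableC; apply: open_borel.
exact: closed_openC.
Qed.

Lemma continuous_borel (f : G -> G) :
  continuous f -> measurable_fun setT (f : borelType G -> borelType G).
Proof.
move=> cf.
apply: (@measurability _ _ (borelType G) (borelType G) setT f (@open G)) => //.
move=> _ [U oU <-]; rewrite setTI; apply: open_borel.
by apply: open_comp => // x _; exact: cf.
Qed.

Lemma compact_finite_net (e : R) : compact [set: G] -> 0 < e ->
  exists2 D : set G, finite_set D & forall x, exists2 a, D a & d a x < e.
Proof.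
move=> cG e0.
pose T : ptopologicalType :=
  HB.pack (TopologicalZmodule.sort G)
    (isPointed.Build (TopologicalZmodule.sort G) 0).
have : @cover_compact T setT by rewrite -compact_cover.
move=> /(_ G setT (fun a => [set y | d a y < e])) [].
- by move=> a _; exact: (metrizes_open_ball d_metric).
- move=> x _; exists x => //=; case: d_metric => d0 _ _ _.
  by rewrite (d0 x x).2.
move=> D _ Dcov; exists [set` D]; first exact: finite_fset.
by move=> x; have [a Da /= ax] := Dcov x I; exists a.
Qed.

(* Finite 1/n-nets write an open set of the square as a countable union of
   products of balls. *)
Lemma continuous2_borel (f : G * G -> G) : compact [set: G] -> continuous f ->
  measurable_fun setT (f : borelType G * borelType G -> borelType G).
Proof.
move=> cG cf.
apply: (@measurability _ _ (borelType G * borelType G)%type (borelType G) setT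
  f (@open G)) => //.
move=> _ [U oU <-]; rewrite setTI.
have [D Dfin Dnet] : exists2 D : nat -> set G, (forall n, finite_set (D n)) &
    forall n x, exists2 a, D n a & d a x < n.+1%:R^-1.
  have /choice[D HD] (n : nat) : exists D : set G, finite_set D /\
      forall x, exists2 a, D a & d a x < n.+1%:R^-1.
    by have [||D ? ?] := @compact_finite_net n.+1%:R^-1 => //; exists D.
  by exists D => n; have [] := HD n.
pose bb n (ab : G * G) : set (borelType G * borelType G) :=
  [set y | d ab.1 y < n.+1%:R^-1] `*` [set y | d ab.2 y < n.+1%:R^-1].
pose I n := (D n `*` D n) `&` [set ab | bb n ab `<=` f @^-1` U].
have -> : f @^-1` U = \bigcup_n \bigcup_(ab in I n) bb n ab.
  apply/seteqP; split => [[x y] Uxy|z [n _ [ab [_ abU] /abU]]]; last by [].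
  have : nbhs (x, y) (f @^-1` U) by apply: cf; exact: open_nbhs_nbhs.
  case => -[V W] /= [nV nW] VWU.
  case: d_metric => _ _ _ dn.
  have [e e0 eV] := (dn _ _).1 nV; have [e' e'0 eW] := (dn _ _).1 nW.
  (* Half of the smaller radius: a net ball of radius [n.+1%:R^-1] that contains [x] then lies in
     the ball of radius [e] about [x], and likewise for [y] and [e']. *)
  have [n ne] : exists n : nat, n.+1%:R^-1 < Num.min e e' / 2.
    have : 0 < Num.min e e' / 2 by rewrite divr_gt0// lt_min e0.
    by move=> /ltr_add_invr [n]; rewrite add0r => ?; exists n.
  have [] : n.+1%:R^-1 < e / 2 /\ n.+1%:R^-1 < e' / 2.
    by split; apply: (lt_le_trans ne);
      rewrite ler_pM2r ?invr_gt0// ge_min lexx ?orbT.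
  have [[a Da ax] [b Db yb]] := (Dnet n x, Dnet n y).
  move=> re re'; exists n => //; exists (a, b) => //.
  split=> // -[u v] [/= au bv].
  apply: VWU; split => /=.
    exact/eV/(metrizes_ball_half d_metric re ax).
  exact/eW/(metrizes_ball_half d_metric re' yb).
apply: bigcupT_measurable => n; apply: fin_bigcup_measurable.
  by apply: finite_setIl; exact: finite_setX.
by move=> ab _; apply: measurableX; apply: open_borel;
  exact: (metrizes_open_ball d_metric).
Qed.

End Borel.

(** * Haar measure: compactness of the group and invariance under automorphisms *)

Section Haar.
Variables (R : realType) (G : topologicalZmodType) (d : G -> G -> R).
Hypothesis d_metric : metrizes d.
Variable lambda : {measure set (borelType G) -> \bar R}.
Hypothesis lambda_haar : is_haar lambda.
Hypothesis lambda_norm : lambda [set: G] = 1%E.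

Let addG_continuous : continuous (fun xy : G * G => xy.1 + xy.2).
Proof. exact: add_continuous. Qed.

(* Inner regularity gives a compact [K] of measure more than 1/2; any two
   translates of [K] meet, so [K - K = G]. *)
Lemma haar_prob_compact : compact [set: G].
Proof.
case: lambda_haar => _ lam_tr _ _ lam_inner.
have [K cK Kgt] : exists2 K : set G, compact K & (2^-1%:E < lambda K)%E.
  have : (2^-1%:E < lambda [set: G])%E by rewrite lambda_norm lte_fin; lra.
  rewrite (lam_inner _ openT) => /ereal_sup_gt[_ [K [cK _] <-]] ?.
  by exists K.
have mK : measurable (K : set (borelType G)).
  apply: (@closed_borel G K).
  exact: (compact_closed (metrizes_hausdorff d_metric)).
have -> : [set: G] = (fun xy : G * G => xy.1 - xy.2) @` (K `*` K).
  apply/seteqP; split => // g _; apply: contrapT => ng.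
  (* [L] is the translate [K + g]. It is disjoint from [K] when [g] is not a difference of two
     points of [K]; both then have measure above 1/2 in a space of measure 1. *)
  pose L : set (borelType G) := [set u | K (u - g)].
  have lamL : lambda L = lambda K.
    rewrite -(lam_tr g _ mK); congr (lambda _).
    apply/seteqP; split => [u Ku|_ [u Ku <-]]; last first.
      by rewrite /L /= addrC addKr.
    by exists (u - g) => //; rewrite addrC subrK.
  have mL : measurable L.
    rewrite -[X in measurable X]setTI.
    apply: (@continuous_borel G (fun u => u - g)) => // u.
    apply: (@continuous_comp _ _ _ (fun u => (u, - g))
      (fun xy : G * G => xy.1 + xy.2)); last exact: addG_continuous.
    by apply: cvg_pair; [exact: cvg_id | exact: cvg_cst].
  have : (lambda (K `|` L) <= lambda [set: G])%E.
    apply: (@le_measure _ _ (borelType G) lambda) => //; apply/mem_set;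
      last exact: (@measurableT _ (borelType G)).
    exact: (@measurableU _ (borelType G)).
  have -> : lambda (K `|` L) = (lambda K + lambda L)%E.
    apply: measureU => //.
    apply/seteqP; split => // u [Ku Lu]; apply: ng; exists (u, u - g) => //=.
    by rewrite opprB addrC subrK.
  rewrite lamL lambda_norm leNgt => /negP; apply.
  have -> : (1 = 2^-1%:E + 2^-1%:E :> \bar R)%E.
    by rewrite -EFinD; congr EFin; lra.
  exact: lteD.
apply: continuous_compact; last exact: compact_setX.
apply: continuous_subspaceT => xy.
apply: (@continuous_comp _ _ _ (fun xy : G * G => (xy.1, - xy.2))
  (fun xy : G * G => xy.1 + xy.2)); last exact: addG_continuous.
apply: cvg_pair; first exact: cvg_fst.
apply: (@continuous_comp _ _ _ snd -%R); first exact: cvg_snd.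
exact: opp_continuous.
Qed.

(* Both sides are the product measure of [(x, y) | A x + y \in U], sliced
   along each of the two variables. *)
Lemma haar_aut (A : topAut G) (U : set (borelType G)) :
  measurable U -> lambda (A @^-1` U) = lambda U.
Proof.
move=> mU; case: lambda_haar => _ lam_tr _ _ _.
(* Finiteness and sigma-finiteness are bundled with [lambda] into [mu], to which product measures
   apply. *)
have lam_fin : fin_num_fun lambda.
  by apply: lty_fin_num_fun; rewrite lambda_norm ltry.
pose H1 := isFinite.Build _ _ _ _ lam_fin.
have lam_sigma : sigma_finite [set: borelType G] lambda.
  by apply: fin_num_fun_sigma_finite => //; rewrite measure0.
pose H2 := isSFinite.Build _ _ _ _ (sfinite_measure_sigma_finite lam_sigma).
pose H3 := isSigmaFinite.Build _ _ _ _ lam_sigma.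
pose mu := HB.pack_for (FiniteMeasure.type (borelType G) R)
  (Measure.sort lambda) H1 H2 H3.
pose f (xy : G * G) := A xy.1 + xy.2.
have mf : measurable_fun setT (f : borelType G * borelType G -> borelType G).
  apply: (continuous2_borel d_metric haar_prob_compact) => xy.
  apply: (@continuous_comp _ _ _ (fun xy : G * G => (A xy.1, xy.2))
    (fun xy : G * G => xy.1 + xy.2)); last exact: addG_continuous.
  apply: cvg_pair; last exact: cvg_snd.
  apply: (@continuous_comp _ _ _ fst A); first exact: cvg_fst.
  exact: aut_continuous.
have mS : measurable (f @^-1` U : set (borelType G * borelType G)).
  by rewrite -[X in measurable X]setTI; exact: mf.
(* The two iterated integrals agree on rectangles, hence everywhere by uniqueness of the product
   measure. *)
have : ((mu \x mu) (f @^-1` U) = (mu \x^ mu) (f @^-1` U))%E.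
  by apply: product_measure_unique => // V W mV mW; exact: product_measure2E.
rewrite /product_measure1 /product_measure2.
(* The section at [x] is the translate of [U] by [- A x], so its measure is constant in [x]. *)
rewrite (_ : mu \o _ = cst (lambda U)); last first.
  apply/funext => x /=; rewrite -[RHS](lam_tr (- A x))//.
  apply: (congr1 lambda).
  rewrite xsectionE; apply/seteqP; split => [y|_ [u Uu <-]]; rewrite /f /=.
    by move=> ?; exists (A x + y) => //; rewrite addKr.
  by rewrite addrA subrr add0r.
(* The section at [y] is the translate of the preimage of [U] by [- aut_inv A y]. *)
rewrite (_ : mu \o _ = cst (lambda (A @^-1` U))); last first.
  apply/funext => y /=; rewrite -[RHS](lam_tr (- aut_inv A y)); last first.
    rewrite -[X in measurable X]setTI; apply: continuous_borel => //.
    exact: aut_continuous.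
  apply: (congr1 lambda).
  rewrite ysectionE; apply/seteqP; split => [x|_ [u Uu <-]]; rewrite /f /=.
    move=> ?; exists (aut_inv A y + x) => //=; last by rewrite addKr.
    by rewrite aut_add aut_valK addrC.
  by rewrite -{2}[y](aut_valK A) -aut_add addrC addrA subrr add0r.
by rewrite !integral_cst// lambda_norm !mule1.
Qed.

End Haar.

(** * Integrals under measure-preserving bijections *)

Section MeasurePreserving.
Context d (T : measurableType d) (R : realType).
Variable mu : {measure set T -> \bar R}.
Import HBNNSimple.

(** A simple function [h] below [f] yields the simple function [h \o phi] below [g]. Its level sets
    are the preimages of those of [h], so the two have the same integral. *)
Lemma sup_sintegral_comp_le (phi : T -> T) (f g : T -> \bar R) :
  f \o phi =1 g -> measurable_fun setT phi ->
  (forall U, measurable U -> mu (phi @^-1` U) = mu U) ->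
  (ereal_sup [set sintegral mu h |
     h in [set h : {nnsfun T >-> R} | forall x, (h x)%:E <= f x]] <=
   ereal_sup [set sintegral mu h |
     h in [set h : {nnsfun T >-> R} | forall x, (h x)%:E <= g x]])%E.
Proof.
move=> fg mphi mu_phi; apply: ge_ereal_sup => _ [h hf <-].
have mh : measurable_fun setT (h \o phi) by exact: measurableT_comp.
have fh : finite_set (range (h \o phi)).
  by apply: (sub_finite_set _ (fimfunP h)) => _ [x _ <-]; exists (phi x).
have h0 x : 0 <= (h \o phi) x by [].
pose H1 := isMeasurableFun.Build _ _ _ _ _ mh.
pose H2 := FiniteImage.Build _ _ _ fh.
pose H3 := isNonNegFun.Build _ _ _ h0.
pose k := HB.pack_for {nnsfun T >-> R} (h \o phi) H1 H2 H3.
apply: ereal_sup_ubound; exists k; first by move=> x; rewrite -fg; exact: hf.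
rewrite /sintegral; apply: eq_fsbigr => x _; congr (_ * _)%E.
by rewrite -[RHS]mu_phi.
Qed.

(* The function is not assumed to be measurable, as the integral is defined
   as a supremum over simple functions. *)
Lemma integral_measure_preserving (phi psi : T -> T) (f : T -> \bar R) :
  cancel phi psi -> cancel psi phi ->
  measurable_fun setT phi -> measurable_fun setT psi ->
  (forall U, measurable U -> mu (phi @^-1` U) = mu U) ->
  (\int[mu]_x f (phi x) = \int[mu]_x f x)%E.
Proof.
move=> phiK psiK mphi mpsi mu_phi.
have mu_psi U : measurable U -> mu (psi @^-1` U) = mu U.
  move=> mU; rewrite -[LHS]mu_phi; last first.
    by rewrite -[X in measurable X]setTI; exact: mpsi.
  by congr (mu _); apply/funext => x /=; rewrite phiK.
have sup_eq g : ereal_sup [set sintegral mu h |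
     h in [set h : {nnsfun T >-> R} | forall x, ((h x)%:E <= g (phi x))%E]] =
   ereal_sup [set sintegral mu h |
     h in [set h : {nnsfun T >-> R} | forall x, ((h x)%:E <= g x)%E]].
  (* Simple functions are carried across by [psi] for one inequality and by [phi] for the other. *)
  apply/eqP; rewrite eq_le; apply/andP; split.
    by apply: (sup_sintegral_comp_le _ mpsi mu_psi) => x /=; rewrite psiK.
  exact: (sup_sintegral_comp_le _ mphi mu_phi).
rewrite /integral !patch_setT.
have -> : ((fun x => f (phi x))^\+ = f^\+ \o phi)%E.
  by apply/funext => x; rewrite /= !funeposE.
have -> : ((fun x => f (phi x))^\- = f^\- \o phi)%E.
  by apply/funext => x; rewrite /= !funenegE.
by congr (_ - _)%E; exact: sup_eq.
Qed.

End MeasurePreserving.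

(** * Automorphisms and their inverses *)

Section AutAdditive.
Variables (G : topologicalZmodType) (A : topAut G).

Lemma aut0 : A 0 = 0.
Proof. by apply: (addrI (A 0)); rewrite -aut_add !addr0. Qed.

Lemma autN x : A (- x) = - A x.
Proof. by apply/eqP; rewrite -addr_eq0 -aut_add addNr aut0. Qed.

End AutAdditive.

(** Kept transparent: later proofs reduce [aut_symm A] to [aut_inv A] by computation. *)
Definition aut_symm (G : topologicalZmodType) (A : topAut G) : topAut G.
Proof.
apply: (@TopAut G (aut_inv A) A).
- move=> x y; apply: (can_inj (aut_invK A)).
  by rewrite aut_add !aut_valK.
- exact: aut_valK.
- exact: aut_invK.
- exact: aut_inv_continuous.
- exact: aut_continuous.
Defined.

(** * Invariance of small Lebesgue norms and of Fourier coefficients *)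

Section SmallNorm.
Variables (R : realType) (G : topologicalZmodType).
Variable lambda : {measure set (borelType G) -> \bar R}.
Hypothesis lambda_aut : forall (A : topAut G) (U : set (borelType G)),
  measurable U -> lambda (A @^-1` U) = lambda U.

Lemma aut_borel (A : topAut G) :
  measurable_fun setT (A : borelType G -> borelType G).
Proof. by apply: continuous_borel; exact: aut_continuous. Qed.

Lemma integral_aut (A : topAut G) (f : borelType G -> \bar R) :
  (\int[lambda]_x f (A x) = \int[lambda]_x f x)%E.
Proof.
apply: (@integral_measure_preserving _ (borelType G) R lambda A (aut_inv A)).
- exact: aut_invK.
- exact: aut_valK.
- exact: aut_borel.
- exact: (aut_borel (aut_symm A)).
- exact: lambda_aut.
Qed.

(** The quantity [small_term] depends on [g] only through the integrals of the powers of its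
    modulus. With these abstracted as [I], invariance of the integrals gives invariance of the term
    by congruence. *)
Definition small_term_of (theta p : R) (I : R -> \bar R) : \bar R :=
  ereal_inf [set ((eps `^ (- (theta / (p - eps))))%:E *
      I (conj_exp (p - eps)) `^ (conj_exp (p - eps))^-1)%E
    | eps in [set eps : R | 0 < eps < p - 1]].

Lemma small_term_aut (A : topAut G) theta p (g : G -> R[i]) :
  small_term lambda theta p (g \o A) = small_term lambda theta p g.
Proof.
have int_gA : (fun r => \int[lambda]_x (Normc.normc ((g \o A) x) `^ r)%:E)%E =
    (fun r => \int[lambda]_x (Normc.normc (g x) `^ r)%:E)%E.
  apply/funext => r.
  rewrite -(integral_aut A (fun x => (Normc.normc (g x) `^ r)%:E)).
  reflexivity.
exact: (congr1 (small_term_of theta p) int_gA).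
Qed.

Lemma decomposes_aut (A : topAut G) (g : G -> R[i]) (gs : nat -> G -> R[i]) :
  decomposes lambda g gs -> decomposes lambda (g \o A) (fun k => gs k \o A).
Proof.
move=> [mgs [N [mN N0 gsN]]]; split.
  by move=> k; have [mre mim] := mgs k; split;
    [apply: (measurableT_comp mre) | apply: (measurableT_comp mim)];
    exact: aut_borel.
(* The series for [g \o A] at [x] is the series for [g] at [A x]; the exceptional set is thus a
   preimage of a null set, again null. *)
exists (A @^-1` N); split; last by move=> x nx; exact: (gsN (A x) nx).
  by rewrite -[X in measurable X]setTI; exact: aut_borel.
by rewrite lambda_aut.
Qed.

(** Composing every piece of a decomposition of [g] with [A] gives a decomposition of [g \o A] with
    the same sum of terms. *)
Lemma small_norm_aut_le (A : topAut G) theta p (g : G -> R[i]) :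
  (small_norm lambda theta p (g \o A) <= small_norm lambda theta p g)%E.
Proof.
apply: le_ereal_inf_tmp => _ [gs ggs <-]; apply: ereal_inf_lbound.
exists (fun k => gs k \o A); first exact: decomposes_aut.
by apply: eq_eseriesr => k _; rewrite small_term_aut.
Qed.

Lemma small_norm_aut (A : topAut G) theta p (g : G -> R[i]) :
  small_norm lambda theta p (g \o A) = small_norm lambda theta p g.
Proof.
have gA : (g \o A) \o aut_symm A = g.
  by apply/funext => x /=; rewrite aut_valK.
(* The reverse inequality is the same one for the inverse automorphism. *)
have := small_norm_aut_le (aut_symm A) theta p (g \o A).
rewrite gA => g_le.
apply: le_anti; apply/andP; split; [exact: small_norm_aut_le | exact: g_le].
Qed.

Lemma fourier_aut (A : topAut G) (f : G -> R[i]) (s : dual R G) :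
  fourier lambda (f \o A) (adjoint A s) = fourier lambda f s.
Proof.
(* [F] stands for the real or the imaginary part. The integrand on the left is that on the right
   evaluated at [A x], so invariance of the integral concludes. *)
have E (F : R[i] -> R) x : F ((f \o A) x * adjoint A s (- x)) =
    (fun y => F (f y * s (- y))) (A x) by rewrite /= autN.
rewrite /fourier /cintegral /Rintegral.
congr (fine _ +i* fine _)%C; rewrite -[RHS](integral_aut A);
  by apply: eq_integral => x _; rewrite E.
Qed.

End SmallNorm.

(** * Reindexing of sums by a bijection *)

Section Csum.
Variables (R : realType) (I : choiceType).

Lemma rsum_reindex (e : I -> I) (h : I -> R) :
  bijective e -> rsum (h \o e) = rsum h.
Proof.
move=> be; have eb : set_bij [set: I] [set: I] e by rewrite setTT_bijective.
rewrite /rsum (reindex_esum _ _ _ (fun i => (Num.max (h i) 0)%:E) eb).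
by rewrite (reindex_esum _ _ _ (fun i => (Num.max (- h i) 0)%:E) eb).
Qed.

Lemma csum_reindex (e : I -> I) (h : I -> R[i]) :
  bijective e -> csum (h \o e) = csum h.
Proof.
move=> be; rewrite /csum; congr (_ +i* _)%C.
  exact: (rsum_reindex (fun i => complex.Re (h i)) be).
exact: (rsum_reindex (fun i => complex.Im (h i)) be).
Qed.

End Csum.

(** * Quotient groups under an automorphism *)

Section Preimage.
Variables (G : topologicalZmodType) (A : topAut G) (H : zmodClosed G).

(** If [f] factors through the quotient by [H], then [f \o A] factors through the quotient by this
    subgroup. *)
Definition aut_preim : {pred G} := [pred x | A x \in H].

Lemma aut_preim_zmod_closed : zmod_closed aut_preim.
Proof.
split=> [|x y]; rewrite !inE; first by rewrite aut0 rpred0.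
by move=> Ax Ay; rewrite aut_add autN rpredB.
Qed.

HB.instance Definition _ :=
  GRing.isZmodClosed.Build G aut_preim aut_preim_zmod_closed.

End Preimage.

Section QuotientMap.
Variables (G : topologicalZmodType) (A : topAut G) (H1 H2 : zmodClosed G).
Hypothesis H12 : forall x, x \in H1 -> A x \in H2.

Definition quotient_map (q : quotient_group H1) : quotient_group H2 :=
  quotient_proj H2 (A (repr q)).

Lemma quotient_proj_repr (q : quotient_group H1) :
  quotient_proj H1 (repr q) = q.
Proof. exact: reprK. Qed.

(** Independence of the representative: [x] and the chosen representative of its class differ by an
    element of [H1], which [A] sends into [H2]. *)
Lemma quotient_mapE x :
  quotient_map (quotient_proj H1 x) = quotient_proj H2 (A x).
Proof.
rewrite /quotient_map; apply/eqP; rewrite -Quotient.idealrBE -autN -aut_add.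
by apply: H12; rewrite Quotient.idealrBE; apply/eqP; exact: reprK.
Qed.

Lemma quotient_projD (H : zmodClosed G) x y :
  quotient_proj H (x + y) = quotient_proj H x + quotient_proj H y.
Proof. by rewrite /quotient_proj Quotient.pi_add. Qed.

Lemma quotient_projN (H : zmodClosed G) x :
  quotient_proj H (- x) = - quotient_proj H x.
Proof. by rewrite /quotient_proj Quotient.pi_opp. Qed.

Lemma quotient_mapD p q :
  quotient_map (p + q) = quotient_map p + quotient_map q.
Proof.
rewrite -(quotient_proj_repr p) -(quotient_proj_repr q) -quotient_projD.
by rewrite !quotient_mapE aut_add quotient_projD.
Qed.

Lemma quotient_mapN q : quotient_map (- q) = - quotient_map q.
Proof.
rewrite -(quotient_proj_repr q) -quotient_projN.
by rewrite !quotient_mapE autN quotient_projN.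
Qed.

Lemma quotient_map_continuous : continuous quotient_map.
Proof.
apply/continuousP => U oU.
(* By definition of the quotient topology, a set is open when its preimage in [G] is. *)
have -> : open (quotient_map @^-1` U) =
    open (quotient_proj H1 @^-1` (quotient_map @^-1` U)) by [].
have -> : quotient_proj H1 @^-1` (quotient_map @^-1` U) =
    A @^-1` (quotient_proj H2 @^-1` U).
  by apply/funext => x /=; rewrite quotient_mapE.
by move/continuousP: (@aut_continuous G A); apply.
Qed.

End QuotientMap.

(** * Transport of Lie group atlases along an isomorphism *)

Lemma eq_smooth_on (R : realType) n (U : set 'rV[R]_n) (f g : 'rV[R]_n -> R) :
  f =1 g -> smooth_on U f -> smooth_on U g.
Proof. by move=> /funext ->. Qed.

Lemma eq_smooth_map_on (R : realType) n p (U V : set 'rV[R]_n)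
    (f g : 'rV[R]_n -> 'rV[R]_p) :
  U =1 V -> f =1 g -> smooth_map_on U f -> smooth_map_on V g.
Proof. by move=> /funext -> /funext ->. Qed.

Section ChartTransport.
Variables (R : realType) (P Q : PreTopologicalZmodule.type) (n : nat).
Variables (phi : P -> Q) (psi : Q -> P).
Hypotheses (phiK : cancel phi psi) (psiK : cancel psi phi).
Hypotheses (phi_cont : continuous phi) (psi_cont : continuous psi).

Definition chart_pull (c : chart R Q n) : chart R P n :=
  Chart (phi @^-1` chart_dom c) (chart_map c \o phi) (psi \o chart_inv c).

(** With the coordinate images unchanged, transition maps, addition and opposite read in pulled
    charts become the original ones once [phi] cancels [psi]. No derivative has to be computed in
    the transport. *)
Lemma chart_im_pull c : chart_im (chart_pull c) = chart_im c.
Proof.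
apply/seteqP; split => [_ [q cq <-]|_ [q cq <-]]; first by exists (phi q).
by exists (psi q); rewrite /= psiK.
Qed.

Lemma is_chart_pull c : is_chart c -> is_chart (chart_pull c).
Proof.
case=> dom_open im_open mapK map_cont inv_cont; split.
- by apply: open_comp => // x _; exact: phi_cont.
- by rewrite chart_im_pull.
- by move=> x /set_mem cx; rewrite /= mapK ?phiK//; exact/mem_set.
- move=> x cx; apply: continuous_comp; first exact: phi_cont.
  exact: map_cont.
- move=> y; rewrite chart_im_pull => cy.
  by apply: continuous_comp; [exact: inv_cont | exact: psi_cont].
Qed.

Lemma is_smooth_atlas_pull (A : set (chart R Q n)) :
  is_smooth_atlas A -> is_smooth_atlas (chart_pull @` A).
Proof.
case=> A_chart A_cover A_smooth; split.
- by move=> _ [c Ac <-]; apply: is_chart_pull; exact: A_chart.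
- move=> x; have [c Ac cx] := A_cover (phi x).
  by exists (chart_pull c) => //; exists c.
- move=> _ _ [c1 Ac1 <-] [c2 Ac2 <-]; rewrite chart_im_pull /=.
  by apply: eq_smooth_map_on (A_smooth c1 c2 Ac1 Ac2) => y; rewrite /= psiK.
Qed.

Hypothesis phiD : {morph phi : x y / x + y}.
Hypothesis phiN : {morph phi : x / - x}.

Lemma is_lie_atlas_pull (A : set (chart R Q n)) :
  is_lie_atlas A -> is_lie_atlas (chart_pull @` A).
Proof.
case=> A_atlas A_add A_opp; split; first exact: is_smooth_atlas_pull.
- move=> _ _ _ [c1 Ac1 <-] [c2 Ac2 <-] [c3 Ac3 <-]; rewrite !chart_im_pull /=.
  by apply: eq_smooth_map_on (A_add c1 c2 c3 Ac1 Ac2 Ac3) => y;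
    rewrite /= phiD !psiK.
- move=> _ _ [c1 Ac1 <-] [c2 Ac2 <-]; rewrite chart_im_pull /=.
  by apply: eq_smooth_map_on (A_opp c1 c2 Ac1 Ac2) => y; rewrite /= phiN psiK.
Qed.

Lemma atlas_smooth_pull (A : set (chart R Q n)) (F : Q -> R[i]) :
  atlas_smooth A F -> atlas_smooth (chart_pull @` A) (F \o phi).
Proof.
move=> AF _ [c Ac <-]; rewrite chart_im_pull /=.
have [Re_smooth Im_smooth] := AF c Ac.
by split; [apply: eq_smooth_on Re_smooth | apply: eq_smooth_on Im_smooth] => y;
  rewrite /= psiK.
Qed.

End ChartTransport.

(** For [f] induced by [F] on [G / H], the function [f \o A] is induced by [F \o phi] on [G / H'],
    where [H'] is the preimage of [H] under [A]. The map [phi] induced by [A] is an isomorphism of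
    topological groups, along which the Lie atlas is pulled back. *)
Lemma bruhat_smooth_aut (R : realType) (G : topologicalZmodType) (A : topAut G)
    (f : G -> R[i]) :
  bruhat_smooth f -> bruhat_smooth (f \o A).
Proof.
move=> [H [n [At [F [clH At_lie At_F fF]]]]].
pose H' : zmodClosed G := aut_preim A H.
have H'H x : x \in H' -> A x \in H by [].
have HH' x : x \in H -> aut_symm A x \in H' by rewrite inE /= aut_valK.
pose phi := @quotient_map G A H' H.
pose psi := @quotient_map G (aut_symm A) H H'.
have phiK : cancel phi psi.
  move=> q; rewrite -(quotient_proj_repr q) /phi /psi.
  by rewrite (quotient_mapE H'H) (quotient_mapE HH') /= aut_invK.
have psiK : cancel psi phi.
  move=> q; rewrite -(quotient_proj_repr q) /phi /psi.
  by rewrite (quotient_mapE HH') (quotient_mapE H'H) /= aut_valK.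
exists H', n, (@chart_pull _ _ _ n phi psi @` At), (F \o phi); split.
- rewrite (_ : [set x | _] = A @^-1` [set x | x \in H])//.
  by apply: preimage_closed => // x _; exact: aut_continuous.
- apply: is_lie_atlas_pull => //.
  + exact: quotient_map_continuous H'H.
  + exact: quotient_map_continuous HH'.
  + exact: quotient_mapD H'H.
  + exact: quotient_mapN H'H.
- exact: atlas_smooth_pull.
- by move=> x /=; rewrite fF /phi (quotient_mapE H'H).
Qed.

(** * The modulus of the adjoint *)

Lemma adjoint_bij (R : realType) (G : topologicalZmodType) (A : topAut G) :
  bijective (@adjoint R G A).
Proof.
by exists (@adjoint R G (aut_symm A)) => s; apply: dual_ext => x /=;
  rewrite (aut_valK, aut_invK).
Qed.

Lemma counting_image (R : realType) (I : choiceType) (e : I -> I) (U : set I) :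
  injective e -> counting (e @` U) = counting U :> \bar R.
Proof.
move=> e_inj; rewrite /counting.
have -> : finite_set (e @` U) = finite_set U.
  by apply/eq_finite_set/inj_card_eq => x y _ _; exact: e_inj.
case: ifP => // /asboolP fU; rewrite fset_set_image//.
congr (_%:R%:E); exact: (finmap.card_imfset _ _ e_inj).
Qed.

(** A bijection preserves cardinality, so 1 is an admissible constant. Uniqueness ensures that the
    choice made by [xget] is this one. *)
Lemma dual_modulus_bij (R : realType) (G : topologicalZmodType)
    (B : dual R G -> dual R G) : bijective B -> dual_modulus B = 1.
Proof.
move=> /bij_inj B_inj; apply: xget_unique => [U|c cB].
  by rewrite mul1e counting_image.
(* A singleton has counting measure 1, which forces [c] to be 1. *)
have := cB [set 0]; rewrite counting_image// /counting asboolT//.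
by rewrite fset_set1 cardfs1 mule1 => -[].
Qed.

(** * Dilated multipliers *)

Section Dilation.
Variables (R : realType) (G : topologicalZmodType).
Variable lambda : {measure set (borelType G) -> \bar R}.
Hypothesis lambda_aut : forall (A : topAut G) (U : set (borelType G)),
  measurable U -> lambda (A @^-1` U) = lambda U.
Variable A : topAut G.

Lemma dilationE c (m : dual R G * dual R G -> R[i]) st :
  dilation c (adjoint A) m st = m (adjoint A st.1, adjoint A st.2).
Proof.
by rewrite /dilation dual_modulus_bij ?powR1 ?mul1r//; exact: adjoint_bij.
Qed.

Lemma bilin_dilation c (m : dual R G * dual R G -> R[i]) (f g : G -> R[i]) :
  bilin lambda (dilation c (adjoint A) m) f g =
  bilin lambda m (f \o A) (g \o A) \o aut_symm A.
Proof.
apply/funext => x; rewrite /bilin /=.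
rewrite -[RHS](csum_reindex _ (@adjoint_bij R G A)).
congr csum; apply/funext => s /=.
rewrite -[RHS](csum_reindex _ (@adjoint_bij R G A)).
congr csum; apply/funext => t /=.
(* The coefficient of [f \o A] at [adjoint A s] is that of [f] at [s], and the adjoint characters
   evaluated at [aut_symm A x] give [s] and [t] at [x]. *)
by rewrite !(fourier_aut lambda_aut) dilationE /= aut_valK.
Qed.

(** The bound for [m] is applied to [f \o A] and [g \o A]; composition with [A] or its inverse
    changes none of the three norms, so [C] is kept. *)
Lemma bilin_bound_dilation theta p1 p2 p3 c m C :
  bilin_bound lambda theta p1 p2 p3 m C ->
  bilin_bound lambda theta p1 p2 p3 (dilation c (adjoint A) m) C.
Proof.
move=> [C0 mC]; split; [exact: C0 | move=> f g f_smooth g_smooth].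
have := mC _ _ (bruhat_smooth_aut A f_smooth) (bruhat_smooth_aut A g_smooth).
rewrite (small_norm_aut lambda_aut A theta p1 f).
rewrite (small_norm_aut lambda_aut A theta p2 g).
rewrite bilin_dilation.
rewrite (small_norm_aut lambda_aut (aut_symm A) theta p3).
exact.
Qed.

End Dilation.

Theorem theorem3 (R : realType) (G : topologicalZmodType)
  (d : G -> G -> R) (d_metric : metrizes d)
  (lambda : {measure set (borelType G) -> \bar R})
  (G_lc : locally_compact [set: G])
  (lambda_haar : is_haar lambda)
  (lambda_fin : (lambda [set: G] < +oo)%E)
  (lambda_norm : lambda [set: G] = 1%E)
  (p1 p2 p3 theta invq : R)
  (p1_gt1 : 1 < p1) (p2_gt1 : 1 < p2) (p3_gt1 : 1 < p3)
  (theta_ge0 : 0 <= theta)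
  (invqE : invq = (conj_exp p1)^-1 + (conj_exp p2)^-1 - (conj_exp p3)^-1)
  (A : topAut G)
  (m : dual R G * dual R G -> R[i])
  (m_mult : bilin_mult lambda theta p1 p2 p3 m) :
  bilin_mult lambda theta p1 p2 p3 (dilation invq (adjoint A) m) /\
  (mult_norm lambda theta p1 p2 p3 (dilation invq (adjoint A) m)
     <= mult_norm lambda theta p1 p2 p3 m)%E.
Proof.
have lambda_aut := haar_aut d_metric lambda_haar lambda_norm.
have bound_dil := bilin_bound_dilation lambda_aut A invq.
case: m_mult => -[M mM] [C mC]; split.
  split; last (exists C; exact: bound_dil mC).
  (* The modulus being 1, the dilated multiplier takes only values of [m]. *)
  by exists M => st; rewrite dilationE.
(* The infimum for the dilated multiplier runs over a set containing all bounds for [m]. *)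
apply: le_ereal_inf_tmp => _ [C' mC' <-]; apply: ereal_inf_lbound.
exists C'; [exact: bound_dil mC' | reflexivity].
Qed.
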